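(* Let $k$ be a fixed positive integer. For every $\varepsilon>0$ there exists a constant $c=c(k,\varepsilon)>0$ such that for every prime $p$ and every interval $I\subset\mathbb{F}_p\setminus\{0\}$ with $|I|<p^{1/2}$, $$|k(I^{-1})|>c\,|I|^{\frac{2k}{k+1}-\varepsilon}.$$
   Context: $\mathbb{F}_p$ is the field of residue classes modulo the prime $p$; $x^{-1}$ is the inverse in $\mathbb{F}_p$. An interval $I$ in $\mathbb{F}_p$ is a non-empty set of residue classes of consecutive integers $M+1,\dots,M+N$ with $1\le N\le p$, and $|I|=N$. Here $I^{-1}=\{x^{-1}: x\in I\}$ and $k(I^{-1})=\{x_1^{-1}+\dots+x_k^{-1}: x_1,\dots,x_k\in I\}\subset\mathbb{F}_p$. *)

(* Defs.v *)
From HB Require Import structures.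
From mathcomp Require Import all_boot all_algebra.

Set Implicit Arguments.
Unset Strict Implicit.
Unset Printing Implicit Defensive.

Import GRing.Theory.

Local Open Scope ring_scope.

(* ['F_p] is the field of residues modulo [p] only when [p] is prime; the
   definitions below are meant to be used under that hypothesis. *)

(* [j : 'I_N] runs over 0, ..., N-1, so the classes listed are those of
   M+1, ..., M+N; for [N <= p] these are pairwise distinct, so #|I| = N. *)
Definition Fp_interval (p : nat) (I : {set 'F_p}) : Prop :=
  exists (M : int) (N : nat),
    (1 <= N <= p)%N /\ I = [set (M + (j.+1)%:Z)%:~R | j : 'I_N].

(* The set k(I^-1); the summands are not required to be distinct. *)
Definition recip_sumset (p k : nat) (I : {set 'F_p}) : {set 'F_p} :=
  [set \sum_(i < k) (x i)^-1 | x : {ffun 'I_k -> 'F_p} in ffun_on (mem I)].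

(* Main.v *)
Require Import Defs.
From HB Require Import structures.
From mathcomp Require Import all_boot all_order all_algebra.
From mathcomp Require Import all_classical all_reals all_analysis.
From mathcomp Require Import zify ring lra.

Set Implicit Arguments.
Unset Strict Implicit.
Unset Printing Implicit Defensive.

Import Order.TTheory GRing.Theory Num.Theory.

Local Open Scope ring_scope.

(* Write I = {a + i : i < N} and split N ~ S m with m = N^(2/(k+1) - eps/k).
   For S <= s < 2S and i < N/2, the progression {a + i + s r : r < m} lies in
   I, and the sums of k reciprocals of its elements are, up to the factor 1/s,
   the sums of k terms 1/(y + r) with y = (a + i)/s.  Two different k-subsets
   of {r < m} give the same sum for at most 2k values of y (the logarithmic
   derivatives of two distinct monic polynomials are distinct rational
   functions).  Since N^2 < p, the ratios y take almost N S ~ N^2/m >= m^k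
   distinct values, so for some y only boundedly many coincidences per subset
   occur, and Cauchy-Schwarz gives about m^k ~ N^(2k/(k+1) - eps) sums. *)

(** * Counting collisions of a map *)

(** Cauchy-Schwarz over the fibres of [f]: the fibre sizes add up to [#|A|], and their squares to
    the number of colliding pairs. *)
Lemma sum_collisions (T U : finType) (f : T -> U) (A : {set T}) :
  (#|A| ^ 2 <= #|f @: A| * \sum_(a in A) \sum_(b in A) (f a == f b))%N.
Proof.
pose n u := #|[set b in A | f b == u]|.
have nE (F : U -> nat) :
    (\sum_(a in A) F (f a) = \sum_(u in f @: A) n u * F u)%N.
  rewrite (partition_big f (mem (f @: A))) => [|a]; last exact: imset_f.
  apply: eq_bigr => u _; rewrite /n -sum1_card big_distrl /=.
  apply: eq_big => [a|a /andP[_ /eqP->]]; first by rewrite inE.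
  by rewrite mul1n.
have -> : (\sum_(a in A) \sum_(b in A) (f a == f b)
          = \sum_(u in f @: A) n u * n u)%N.
  rewrite -nE; apply: eq_bigr => a _.
  rewrite /n -sum1_card big_mkcond [RHS]big_mkcond /=; apply: eq_bigr => b _.
  by rewrite inE eq_sym; case: (b \in A) => //=; case: eqP.
have -> : (#|A| = \sum_(u in f @: A) n u)%N.
  rewrite -sum1_card (nE (fun=> 1%N)); apply: eq_bigr => u _; exact: muln1.
(* Both sides are doubled, so that it is enough to sum [2 * (n u * n v) <= n u ^ 2 + n v ^ 2] over
   pairs of fibres. *)
set V := f @: A; rewrite -(leq_pmul2l (m := 2)) //.
rewrite expnS expn1 big_distrl big_distrr /=.
have -> : (2 * (#|V| * \sum_(u in V) n u * n u) =
   \sum_(u in V) \sum_(v in V) (n u ^ 2 + n v ^ 2))%N.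
  under [RHS]eq_bigr do rewrite big_split /= sum_nat_const.
  rewrite big_split /= sum_nat_const -big_distrr /=.
  under [X in (_ = _ * X + _)%N]eq_bigr do rewrite -mulnn.
  under [X in (_ = _ + _ * X)%N]eq_bigr do rewrite -mulnn.
  by rewrite addnn mul2n.
apply: leq_sum => u _; rewrite !big_distrr /=; apply: leq_sum => v _.
exact: nat_Cauchy.
Qed.

(** * Polynomials with equal logarithmic derivatives *)

Lemma deriv_eq0_size (F : fieldType) (k : nat) (u : {poly F}) :
  (forall n, (0 < n <= k)%N -> n%:R != 0 :> F) ->
  (size u <= k.+1)%N -> u^`() = 0 -> (size u <= 1)%N.
Proof.
move=> char_gt szu du0; rewrite leqNgt; apply/negP => szu1.
have : u^`()`_(size u).-2 = 0 by rewrite du0 coef0.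
rewrite coef_deriv; have -> : ((size u).-2.+1 = (size u).-1)%N by lia.
rewrite -lead_coefE -mulr_natr => /eqP; rewrite mulf_eq0 lead_coef_eq0.
case/orP=> [/eqP u0|/negPn]; first by rewrite u0 size_poly0 in szu1.
by rewrite char_gt //; lia.
Qed.

(** After division by the gcd, the coprime cofactors satisfy u'v = uv'. Hence u divides u', so u' =
    0 by degree, and the condition on the characteristic makes u constant; likewise v. Monicity
    makes the two constants equal. *)
Lemma eq_of_wronskian0 (F : fieldType) (k : nat) (P Q : {poly F}) :
  (forall n, (0 < n <= k)%N -> n%:R != 0 :> F) ->
  P \is monic -> Q \is monic -> (size P <= k.+1)%N -> (size Q <= k.+1)%N ->
  P^`() * Q = P * Q^`() -> P = Q.
Proof.
move=> char_gt Pm Qm szP szQ W0.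
have P0 := monic_neq0 Pm; have Q0 := monic_neq0 Qm.
pose d := gcdp P Q.
have d0 : d != 0 by rewrite gcdp_eq0 negb_and P0.
pose u := P %/ d; pose v := Q %/ d.
have Pu : P = u * d by rewrite divpK ?dvdp_gcdl.
have Qv : Q = v * d by rewrite divpK ?dvdp_gcdr.
have cuv : coprimep u v by apply: coprimep_div_gcd; rewrite P0.
have Wuv : u^`() * v = u * v^`().
  (* Multiplied by d^2, the two sides differ from P'Q and PQ' by the same term u v d d'. *)
  apply: (mulfI d0); apply: (mulfI d0).
  apply: (@addIr _ (u * v * d * d^`())).
  transitivity (P^`() * Q); first by rewrite Pu Qv derivM; ring.
  rewrite W0 Pu Qv derivM; ring.
have const (w x : {poly F}) : w != 0 -> (size w <= k.+1)%N -> coprimep w x ->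
    w^`() * x = w * x^`() -> (size w <= 1)%N.
  move=> w0 szw cwx Wwx; apply: (deriv_eq0_size char_gt szw).
  apply/eqP; apply: contraTT (lt_size_deriv w0) => dw0; rewrite -leqNgt.
  apply: dvdp_leq => //; rewrite -(Gauss_dvdpl _ cwx) Wwx; exact: dvdp_mulr.
have u0 : u != 0 by apply: contraNneq P0 => u0; rewrite Pu u0 mul0r.
have v0 : v != 0 by apply: contraNneq Q0 => v0; rewrite Qv v0 mul0r.
have /size1_polyC uC : (size u <= 1)%N.
  apply: (const u v) => //; apply: leq_trans szP.
  by rewrite Pu size_mul // -subn1 -addnBA ?leq_addr // lt0n size_poly_eq0.
have /size1_polyC vC : (size v <= 1)%N.
  apply: (const v u) => //; last 1 first.
  - by rewrite mulrC -Wuv mulrC.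
  - apply: leq_trans szQ.
    by rewrite Qv size_mul // -subn1 -addnBA ?leq_addr // lt0n size_poly_eq0.
  - by rewrite coprimep_sym.
have lu : lead_coef P = u`_0 * lead_coef d.
  by rewrite Pu lead_coefM uC lead_coefC coefC.
have lv : lead_coef Q = v`_0 * lead_coef d.
  by rewrite Qv lead_coefM vC lead_coefC coefC.
have /mulIf e : lead_coef d != 0 by rewrite lead_coef_eq0.
rewrite Pu Qv uC vC; congr (_%:P * _); apply: e.
by rewrite -lu -lv (monicP Pm) (monicP Qm).
Qed.

Lemma sum_invr_logderiv (F : fieldType) (y : F) (s : seq F) : y \notin s ->
  \sum_(d <- s) (y - d)^-1 =
    (\prod_(d <- s) ('X - d%:P))^`().[y] / (\prod_(d <- s) ('X - d%:P)).[y].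
Proof.
elim: s => [|d s IH]; first by rewrite !big_nil -polyC1 derivC horner0 mul0r.
rewrite inE negb_or -subr_eq0 => /andP[yd ys]; rewrite !big_cons IH //.
rewrite derivM derivXsubC !hornerE.
have Q0 : (\prod_(e <- s) ('X - e%:P)).[y] != 0.
  by rewrite -rootE root_prod_XsubC.
by field; rewrite yd Q0.
Qed.

(** * Coincidences among the ratios (a + i)/s *)

(** Each gcd is at most the sum of all common divisors g. At most [n %/ g] members of [s] are
    multiples of g, so g contributes at most [g * (n %/ g) ^ 2 <= n * (n %/ g)]. *)
Lemma sum_gcdn_le (n : nat) (s : seq nat) :
  uniq s -> {in s, forall x, 0 < x <= n}%N ->
  (\sum_(x <- s) \sum_(y <- s) gcdn x y <= n * \sum_(1 <= g < n.+1) n %/ g)%N.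
Proof.
move=> s_uniq s_le.
apply: (@leq_trans (\sum_(x <- s) \sum_(y <- s)
    \sum_(1 <= g < n.+1) g * ((g %| x) * (g %| y)))).
  rewrite big_seq [leqRHS]big_seq; apply: leq_sum => x xs.
  apply: leq_sum => y _.
  have /andP[x0 xn] := s_le x xs.
  rewrite (bigD1_seq (gcdn x y)) ?iota_uniq //=; last first.
    rewrite mem_index_iota gcdn_gt0 x0 /= ltnS (leq_trans _ xn) //.
    by rewrite dvdn_leq // dvdn_gcdl.
  by rewrite dvdn_gcdl dvdn_gcdr !muln1 leq_addr.
have count_le g : (0 < g)%N -> (\sum_(x <- s) (g %| x) <= n %/ g)%N.
  have sumE (r : seq nat) : (\sum_(x <- r) (g %| x) = count (dvdn g) r)%N.
    by rewrite -sum1_count [RHS]big_mkcond; apply: eq_bigr => x _; case: (g %| x)%N.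
  move=> g0; rewrite divn_count_dvd !sumE -!size_filter.
  apply: uniq_leq_size; first exact: filter_uniq.
  move=> x; rewrite !mem_filter mem_index_iota => /andP[-> /s_le].
  by rewrite ltnS.
have -> : (\sum_(x <- s) \sum_(y <- s)
    \sum_(1 <= g < n.+1) g * ((g %| x) * (g %| y)) =
    \sum_(1 <= g < n.+1) g * ((\sum_(x <- s) (g %| x)) ^ 2))%N.
  under eq_bigr do rewrite exchange_big /=.
  rewrite exchange_big /=; apply: eq_bigr => g _.
  rewrite -mulnn big_distrlr big_distrr /=; apply: eq_bigr => x _.
  by rewrite big_distrr.
rewrite big_distrr /= big_nat [leqRHS]big_nat; apply: leq_sum => g /andP[g0 _].
apply: (@leq_trans (g * (n %/ g) ^ 2)).
  by rewrite leq_pmul2l // leq_exp2r // count_le.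
by rewrite -mulnn mulnA leq_mul2r mulnC leq_trunc_div orbT.
Qed.

(** The condition stands for (a + i)/s = (a + j)/t. Two solutions differ by an integer multiple of
    (q, r), where q = s/g and r = t/g are coprime; so all i lie in one class modulo q, and i
    determines j. *)
Lemma card_ratio_collisions (p h s t : nat) (a : 'F_p) :
  prime p -> (0 < s)%N -> (h * (s + t) <= p)%N ->
  (\sum_(i < h) \sum_(j < h) ((a + i%:R) * t%:R == (a + j%:R) * s%:R)%R
    <= (h * gcdn s t) %/ s + 1)%N.
Proof.
move=> p_pr s0 hp.
pose C := [set u : 'I_h * 'I_h |
  (a + u.1%:R) * t%:R == (a + u.2%:R) * s%:R :> 'F_p].
have -> : (\sum_(i < h) \sum_(j < h)
    ((a + i%:R) * t%:R == (a + j%:R) * s%:R)%R = #|C|)%N.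
  rewrite pair_big /= -sum1_card [RHS]big_mkcond /=.
  by apply: eq_bigr => u _; rewrite inE; case: eqP.
set g := gcdn s t; pose q := (s %/ g)%N; pose r := (t %/ g)%N.
have g0 : (0 < g)%N by rewrite gcdn_gt0 s0.
have sq : (s = q * g)%N by rewrite divnK ?dvdn_gcdl.
have tr : (t = r * g)%N by rewrite divnK ?dvdn_gcdr.
have q0 : (0 < q)%N by move: s0; rewrite sq muln_gt0 => /andP[].
have cqr : coprime q r.
  by rewrite /coprime -(eqn_pmul2r g0) muln_gcdl -sq -tr mul1n.
have natF_inj m n : (m < p)%N -> (n < p)%N -> m%:R = n%:R :> 'F_p -> m = n.
  move=> mp np /(congr1 val) /=; rewrite !val_Fp_nat //.
  by rewrite !modn_small.
(* Two solutions differ by a relation that holds mod p between integers < p,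
   hence in the integers. *)
have solE u v : u \in C -> v \in C ->
    (u.1 * t + v.2 * s = v.1 * t + u.2 * s)%N.
  rewrite !inE => /eqP uC /eqP vC; apply: natF_inj.
  - apply: leq_trans hp; rewrite mulnDr; have := ltn_ord u.1.
    by have := ltn_ord v.2; nia.
  - apply: leq_trans hp; rewrite mulnDr; have := ltn_ord v.1.
    by have := ltn_ord u.2; nia.
  rewrite !natrD !natrM; move: uC vC; rewrite !mulrDl => uC vC.
  apply: (@addrI _ (a * t%:R + a * s%:R)).
  transitivity ((a * t%:R + u.1%:R * t%:R) + (a * s%:R + v.2%:R * s%:R)).
    by ring.
  by rewrite uC -vC; ring.
have -> : (h * g %/ s = h %/ q)%N by rewrite sq divnMr.
rewrite addn1.
have lt_q (u : 'I_h * 'I_h) : (u.1 %/ q < (h %/ q).+1)%N.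
  by rewrite ltnS leq_div2r // ltnW.
(* Index of the block of length [q] containing i: a class modulo [q] has at most one member in each
   block. *)
pose f u : 'I_(h %/ q).+1 := Ordinal (lt_q u).
rewrite -[leqRHS]card_ord.
apply: (@leq_card_in _ _ f) => u v uC vC /(congr1 val) /= fuv.
have E := solE u v uC vC.
have E' : (u.1 * r + v.2 * q = v.1 * r + u.2 * q)%N.
  apply/eqP; rewrite -(eqn_pmul2r g0) !mulnDl -!mulnA -sq -tr.
  exact/eqP.
have mod_eq (x y x' y' : nat) : (y <= x)%N ->
    (x * r + y' * q = y * r + x' * q)%N -> x = y %[mod q].
  move=> yx e; apply/eqP; rewrite eqn_mod_dvd //.
  rewrite -(Gauss_dvdl _ cqr) mulnBl.
  have -> : (x * r - y * r = (x' - y') * q)%N by rewrite mulnBl; lia.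
  exact: dvdn_mull.
have mod_uv : u.1 = v.1 %[mod q].
  have [vu|/ltnW uv] := leqP v.1 u.1; first exact: mod_eq E'.
  by apply/esym/(@mod_eq _ _ v.2 u.2).
have e1 : u.1 = v.1.
  by apply: val_inj; rewrite /= (divn_eq u.1 q) fuv mod_uv -divn_eq.
have e2 : u.2 = v.2.
  apply: val_inj; apply/eqP; rewrite -(eqn_pmul2r s0); apply/eqP => /=.
  by move: E; rewrite e1 => /addnI ->.
by rewrite [u]surjective_pairing [v]surjective_pairing e1 e2.
Qed.

(** Cauchy-Schwarz for the map (i, s) -> (a + i)/(S + s), its collisions being bounded by a gcd sum
    over denominators below 2S. *)
Lemma card_ratios_ge (p h S : nat) (a : 'F_p) :
  prime p -> (0 < S <= h)%N -> (4 * h * S <= p)%N ->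
  (h * S ^ 2 <=
   #|[set (a + i%:R) / (S + s)%:R | i : 'I_h, s : 'I_S]|
     * (3 * \sum_(1 <= g < (2 * S).+1) 2 * S %/ g))%N.
Proof.
move=> p_pr /andP[S0 Sh] hp; set D := (\sum_(1 <= g < _) _)%N.
pose f (u : 'I_h * 'I_S) := (a + u.1%:R) / (S + u.2)%:R : 'F_p.
have h0 : (0 < h)%N := leq_trans S0 Sh.
have unitS (s : 'I_S) : (S + s)%:R != 0 :> 'F_p.
  rewrite -(dvdn_pcharf (pchar_Fp p_pr)) gtnNdvd //; first by lia.
  by have := ltn_ord s; nia.
have DS : (2 * S <= D)%N.
  by rewrite /D big_ltn ?divn1 ?leq_addr //; lia.
have := sum_collisions f [set: _]; rewrite cardsT card_prod !card_ord.
set E := (\sum_(u in _) _)%N => CS.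
have EE : (E = \sum_(s < S) \sum_(t < S) \sum_(i < h) \sum_(j < h)
    ((a + i%:R) * (S + t)%:R == (a + j%:R) * (S + s)%:R)%R)%N.
  rewrite /E.
  transitivity (\sum_(u : 'I_h * 'I_S) \sum_(v : 'I_h * 'I_S)
    ((a + u.1%:R) * (S + v.2)%:R == (a + v.1%:R) * (S + u.2)%:R)%R)%N.
    apply: eq_big => [u|u _]; first by rewrite inE.
    apply: eq_big => [v|v _]; first by rewrite inE.
    by rewrite /f eqr_div ?unitS.
  rewrite -(pair_bigA _ (fun (i : 'I_h) (s : 'I_S) => \sum_(v : 'I_h * 'I_S)
    ((a + i%:R) * (S + v.2)%:R == (a + v.1%:R) * (S + s)%:R)%R)%N) /=.
  rewrite exchange_big /=; apply: eq_bigr => s _.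
  rewrite [RHS]exchange_big /=; apply: eq_bigr => i _.
  rewrite -(pair_bigA _ (fun (j : 'I_h) (t : 'I_S) =>
    ((a + i%:R) * (S + t)%:R == (a + j%:R) * (S + s)%:R)%R : nat)) /=.
  exact: exchange_big.
(* Two thirds of the bound come from the gcd sum; the rest dominates S^3, since S <= h and S <=
   D. *)
have ES : (E * S <= 3 * h * S * D)%N.
  have gcd_le : (\sum_(s < S) \sum_(t < S) gcdn (S + s) (S + t) <=
      2 * S * D)%N.
    pose s := [seq (S + val i)%N | i <- enum 'I_S].
    have -> : (\sum_(s < S) \sum_(t < S) gcdn (S + s) (S + t) =
        \sum_(x <- s) \sum_(y <- s) gcdn x y)%N.
      rewrite big_map big_enum; apply: eq_bigr => i _.
      by rewrite big_map big_enum.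
    apply: sum_gcdn_le => [|x /mapP[i _ ->]].
      by rewrite map_inj_uniq ?enum_uniq // => i j /addnI/val_inj.
    by rewrite /=; have := ltn_ord i; lia.
  have ES_gcd : (E * S <=
      h * (\sum_(s < S) \sum_(t < S) gcdn (S + s) (S + t)) + S * (S * S))%N.
    rewrite EE.
    have -> : (S * (S * S) = \sum_(s < S) \sum_(t < S) S)%N.
      by rewrite !sum_nat_const !card_ord.
    rewrite big_distrl big_distrr -big_split /=; apply: leq_sum => s _.
    rewrite big_distrl big_distrr -big_split /=; apply: leq_sum => t _.
    have s0 : (0 < S + s)%N by lia.
    have hst : (h * ((S + s) + (S + t)) <= p)%N.
      by apply: leq_trans hp; have := ltn_ord s; have := ltn_ord t; nia.
    apply: leq_trans (leq_mul (card_ratio_collisions a p_pr s0 hst) (leqnn S)) _.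
    rewrite mulnDl mul1n leq_add2r.
    (* Since S <= S + s, the factor [S] is absorbed by the floor division by S + s. *)
    apply: leq_trans (leq_trunc_div _ (S + s)).
    by rewrite leq_mul2l leq_addr orbT.
  nia.
have EhD : (E <= 3 * h * D)%N by rewrite -(leq_pmul2r S0); nia.
rewrite -(leq_pmul2l h0).
have -> : ([set (a + i%:R) / (S + s)%:R | i : 'I_h, s : 'I_S] =
    f @: [set: 'I_h * 'I_S])%R.
  apply/setP => y; apply/imset2P/imsetP => [[i s _ _ ->]|[[i s] _ ->]].
    by exists (i, s).
  by exists i s.
have -> : (h * (h * S ^ 2) = (h * S) ^ 2)%N by ring.
apply: leq_trans CS _; rewrite mulnCA leq_mul2l; apply/orP; right.
by apply: leq_trans EhD _; rewrite mulnCA mulnA.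
Qed.

(** * Averaging over the evaluation points *)

(** The sums are the logarithmic derivatives at y of the monic polynomials with root sets [A] and
    [B]. Where they agree, y is a root of the Wronskian [W], which is nonzero of degree at most
    2k. *)
Lemma card_eq_sum_invr (F : finFieldType) (k : nat) (A B Y : {set F}) :
  (forall n, (0 < n <= k)%N -> n%:R != 0 :> F) ->
  #|A| = k -> #|B| = k -> A != B -> [disjoint Y & A] -> [disjoint Y & B] ->
  (#|[set y in Y | \sum_(d in A) (y - d)^-1 == \sum_(d in B) (y - d)^-1 :> F]%R|
    <= 2 * k)%N.
Proof.
move=> char_gt cA cB neqAB YA YB.
pose P (C : {set F}) := \prod_(d <- enum C) ('X - d%:P).
have szP C : size (P C) = #|C|.+1 by rewrite size_prod_XsubC -cardE.
have rootP C y : root (P C) y = (y \in C) by rewrite root_prod_XsubC mem_enum.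
pose W := (P A)^`() * P B - P A * (P B)^`().
have W0 : W != 0.
  rewrite subr_eq0; apply: contra neqAB => /eqP WAB; apply/eqP/setP => d.
  rewrite -!rootP; congr (root _ d).
  apply: (eq_of_wronskian0 char_gt) WAB;
    by rewrite ?monic_prod_XsubC ?szP ?cA ?cB.
have szW : (size W <= (2 * k).+1)%N.
  have szM (C C' : {set F}) : #|C| = k -> #|C'| = k ->
      (size ((P C)^`() * P C')%R <= (2 * k).+1)%N.
    move=> cC cC'; apply: leq_trans (size_polyMleq _ _) _.
    have := lt_size_deriv (monic_neq0 (monic_prod_XsubC _ _ _) : P C != 0).
    rewrite !szP cC cC'; lia.
  apply: leq_trans (size_polyD _ _) _; rewrite size_polyN geq_max szM //=.
  by rewrite mulrC szM.
rewrite -ltnS (leq_trans _ szW) // cardE.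
apply: max_poly_roots (enum_uniq _) => //; apply/allP => y.
rewrite mem_enum inE => /andP[yY /eqP].
have notin (C : {set F}) : [disjoint Y & C] -> y \notin enum C.
  by move=> YC; rewrite mem_enum (disjointFr YC).
rewrite -!big_enum /= !sum_invr_logderiv ?notin // -/(P A) -/(P B).
have nz (C : {set F}) : [disjoint Y & C] -> (P C).[y] != 0.
  by move=> YC; rewrite -rootE rootP (disjointFr YC).
move/eqP; rewrite eqr_div ?nz // => /eqP e.
by rewrite rootE !hornerE e mulrC subrr.
Qed.

(** Summed over [Y], each k-subset coincides with itself |Y| times and with each other subset at
    most 2k times. As there are at most |Y| subsets, some y has at most 2k + 1 coincidences per
    subset on average, and Cauchy-Schwarz applies to that y. *)
Lemma exists_large_invr_sums (F : finFieldType) (k : nat) (D Y : {set F}) :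
  (forall n, (0 < n <= k)%N -> n%:R != 0 :> F) ->
  [disjoint Y & D] -> Y != finset.set0 -> ('C(#|D|, k) <= #|Y|)%N ->
  exists2 y, y \in Y & ('C(#|D|, k) <= (2 * k).+1 *
    #|[set \sum_(d in A) (y - d)^-1 | A : {set F} in
        [set A : {set F} | A \subset D & #|A| == k]]%R|)%N.
Proof.
move=> char_gt YD Yn0 CY.
pose f y (A : {set F}) := \sum_(d in A) (y - d)^-1.
set T := [set A : {set F} | A \subset D & #|A| == k].
have cT : #|T| = 'C(#|D|, k) by rewrite -cards_draws.
have [C0|C0] := posnP 'C(#|D|, k).
  by have /set0Pn[y yY] := Yn0; exists y => //; rewrite C0.
pose E y := (\sum_(A in T) \sum_(B in T) (f y A == f y B))%N.
have sumE : (\sum_(y in Y) E y <= #|Y| * ((2 * k).+1 * #|T|))%N.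
  have -> : (\sum_(y in Y) E y = \sum_(A in T) \sum_(B in T)
      #|[set y in Y | f y A == f y B]|)%N.
    rewrite exchange_big /=; apply: eq_bigr => A _.
    rewrite exchange_big /=; apply: eq_bigr => B _.
    rewrite -sum1_card [RHS]big_mkcond [LHS]big_mkcond /=.
    by apply: eq_bigr => y _; rewrite inE; case: (y \in Y); case: eqP.
  apply: (@leq_trans (\sum_(A in T) (#|Y| + #|T| * (2 * k)))); last first.
    by rewrite sum_nat_const; rewrite cT; nia.
  apply: leq_sum => A AT; rewrite (bigD1 A) //=; apply: leq_add.
    by apply/subset_leq_card/fintype.subsetP => y; rewrite inE => /andP[].
  apply: (@leq_trans (\sum_(B in T | B != A) 2 * k)).
    apply: leq_sum => B /andP[BT BA].
    move: AT BT; rewrite !inE => /andP[AD /eqP cA] /andP[BD /eqP cB].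
    apply: card_eq_sum_invr; rewrite // 1?eq_sym //.
      exact: disjointWr AD YD.
    exact: disjointWr BD YD.
  rewrite sum_nat_const leq_mul2r subset_leq_card ?orbT //.
  by apply/fintype.subsetP => B /andP[].
have [y yY Ey] : exists2 y, y \in Y & (E y <= (2 * k).+1 * #|T|)%N.
  apply/exists_inP; rewrite -[X in is_true X]negbK negb_exists_in.
  apply/negP => /forall_inP Egt; have /set0Pn[y0 y0Y] := Yn0.
  move: sumE; rewrite leqNgt => /negP; apply.
  rewrite -sum_nat_const.
  have lt0 y : y \in Y -> ((2 * k).+1 * #|T| < E y)%N.
    by move=> /Egt; rewrite -ltnNge.
  rewrite (bigD1 y0) //= [ltnRHS](bigD1 y0) //= -addSn leq_add ?lt0 //.
  by apply: leq_sum => y /andP[/lt0/ltnW].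
exists y => //; rewrite -cT.
have := sum_collisions (f y) T; rewrite -/(E y) => CS.
rewrite -cT in C0; rewrite -(leq_pmul2r C0) mulnn.
apply: leq_trans CS _; apply: leq_trans (leq_mul (leqnn _) Ey) _.
by rewrite mulnA [X in (X * _ <= _)%N]mulnC.
Qed.

(** * Transfer to the interval *)

(** Meant for [c] = s and [g d] = y - d, where y is a ratio with denominator s. *)
Lemma sum_invr_in_recip_sumset (p k : nat) (I A : {set 'F_p}) (c : 'F_p)
    (g : 'F_p -> 'F_p) :
  #|A| = k -> {in A, forall d, c * g d \in I} ->
  c^-1 * \sum_(d in A) (g d)^-1 \in recip_sumset k I.
Proof.
move=> cA AI; apply/imsetP.
exists [ffun j : 'I_k => c * g (nth 0 (enum A) j)].
  apply/ffun_onP => j; rewrite ffunE; apply: AI.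
  by rewrite -mem_enum mem_nth // -cardE cA.
rewrite -big_enum (big_nth 0) -cardE cA big_mkord mulr_sumr.
by apply: eq_bigr => j _; rewrite ffunE invfM.
Qed.

Lemma recip_sumset_ge_bin (p k h S m N : nat) (a : 'F_p) :
  prime p -> (k < p)%N -> (0 < S <= h)%N -> (4 * h * S <= p)%N -> (m <= p)%N ->
  (h + 2 * S * m <= N)%N -> 0 \notin [set a + i%:R | i : 'I_N]%R ->
  ('C(m, k) * (3 * \sum_(1 <= g < (2 * S).+1) 2 * S %/ g) <= h * S ^ 2)%N ->
  ('C(m, k) <= (2 * k).+1 * #|recip_sumset k [set a + i%:R | i : 'I_N]%R|)%N.
Proof.
move=> p_pr kp Shh hSp mp hSN I0; have /andP[S0 Sh] := Shh.
set sigma := (\sum_(1 <= g < _) _)%N => Ch.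
set I := [set a + i%:R | i : 'I_N]%R in I0 *.
have nat_neq0 n : (0 < n < p)%N -> n%:R != 0 :> 'F_p.
  by move=> /andP[n0 np]; rewrite -(dvdn_pcharf (pchar_Fp p_pr)) gtnNdvd.
(* Negatives, so that y - d runs over the terms y + r. *)
pose D := [set - (r%:R) | r : 'I_m] : {set 'F_p}.
have cD : #|D| = m.
  rewrite card_imset ?card_ord // => r r' /oppr_inj /(congr1 val) /=.
  have lt_p (i : 'I_m) : (i < p)%N := leq_trans (ltn_ord i) mp.
  by rewrite !val_Fp_nat // !modn_small // => /val_inj.
pose Y := [set (a + i%:R) / (S + s)%:R | i : 'I_h, s : 'I_S] : {set 'F_p}.
have S_neq0 (s : 'I_S) : (S + s)%:R != 0 :> 'F_p.
  by apply: nat_neq0; have := ltn_ord s; nia.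
have inI (i : 'I_h) (s : 'I_S) d :
    d \in D -> (S + s)%:R * ((a + i%:R) / (S + s)%:R - d) \in I.
  move=> /imsetP[r _ ->].
  have lt_N : (i + (S + s) * r < N)%N.
    by have := ltn_ord i; have := ltn_ord s; have := ltn_ord r; nia.
  apply/imsetP; exists (Ordinal lt_N) => //=.
  by rewrite (natrD _ i) natrM; field; rewrite -natrD S_neq0.
(* If y = d, then (S + s)(y - d) = 0 would lie in the interval. *)
have YD : [disjoint Y & D].
  rewrite disjoint_subset; apply/fintype.subsetP => y /imset2P[i s _ _ ->].
  apply: contra I0 => /(inI i s); rewrite subrr mulr0; exact.
have CY : ('C(#|D|, k) <= #|Y|)%N.
  rewrite cD; have sig0 : (0 < 3 * sigma)%N.
    by rewrite muln_gt0 /= /sigma big_ltn ?divn1; lia.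
  rewrite -(leq_pmul2r sig0); apply: leq_trans Ch _.
  exact: card_ratios_ge.
have Yn0 : Y != finset.set0.
  apply/set0Pn; exists ((a + 0%:R) / (S + 0)%:R).
  apply/imset2P; have h0 : (0 < h)%N by exact: leq_trans Sh.
  by exists (Ordinal h0) (Ordinal S0).
have char_gt n : (0 < n <= k)%N -> n%:R != 0 :> 'F_p.
  by move=> /andP[n0 nk]; apply: nat_neq0; rewrite n0 (leq_ltn_trans nk).
have [y /imset2P[i s _ _ yE]] := exists_large_invr_sums char_gt YD Yn0 CY.
rewrite cD yE => /leq_trans; apply; rewrite leq_mul2l /=.
have /mulfI inj_s : (S + s)%:R^-1 != 0 :> 'F_p by rewrite invr_eq0.
rewrite -(card_imset _ inj_s); apply/subset_leq_card/fintype.subsetP => z.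
move=> /imsetP[w /imsetP[A]]; rewrite inE => /andP[AD /eqP cA] -> ->.
by apply: sum_invr_in_recip_sumset => // d dA; apply/inI/(fintype.subsetP AD).
Qed.

(** * Elementary estimates *)

Lemma bin_ge (m k : nat) : ((m - k) ^ k <= 'C(m, k) * k`!)%N.
Proof.
rewrite bin_ffact; elim: k m => // k IH [|m]; first by rewrite sub0n exp0n.
rewrite ffactSS expnS subSS leq_mul ?IH //; lia.
Qed.

(** The induction step is 1/(n+2) <= ln((n+2)/(n+1)), that is, ln(1+x) <= x at x = -1/(n+2). *)
Lemma harmonic_le_ln (R : realType) (n : nat) :
  \sum_(1 <= g < n.+2) g%:R^-1 <= 1 + ln n.+1%:R :> R.
Proof.
elim: n => [|n IH]; first by rewrite big_nat1 invr1 ln1 addr0.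
rewrite big_nat_recr //=; apply: le_trans (lerD IH (lexx _)) _.
rewrite -addrA lerD2l addrC -lerBrDr -opprB lerNr -ln_div ?posrE ?ltr0n //.
have -> : n.+1%:R / n.+2%:R = 1 + - n.+2%:R^-1 :> R.
  have nz : n.+2%:R != 0 :> R by rewrite pnatr_eq0.
  apply: (mulIf nz); rewrite mulrDl mulNr divfK // mul1r mulVf //.
  by rewrite -[n.+2%:R]natr1 addrK.
by apply: le_ln1Dx; rewrite ltrN2 invf_lt1 ?ltr0n ?ltr1n.
Qed.

Lemma sum_divn_le_ln (R : realType) (n : nat) :
  (\sum_(1 <= g < n.+1) n %/ g)%:R <= n%:R * (1 + ln n%:R) :> R.
Proof.
case: n => [|n]; first by rewrite big_geq // mul0r.
apply: le_trans (ler_wpM2l (ler0n _ _) (harmonic_le_ln R n)).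
rewrite natr_sum mulr_sumr big_nat [leRHS]big_nat; apply: ler_sum => g.
move=> /andP[g0 _]; rewrite ler_pdivlMr ?ltr0n // -natrM ler_nat.
exact: leq_trunc_div.
Qed.

(** From ln(1+z) <= z at z = x^d - 1 one gets d ln x <= x^d - 1, and d <= 1 absorbs the remaining
    term. *)
Lemma ln_le_powR (R : realType) (d x : R) : 0 < d <= 1 -> 1 <= x ->
  1 + ln x <= x `^ d / d.
Proof.
move=> /andP[d0 d1] x1; rewrite ler_pdivlMr //.
have := @le_ln1Dx R (x `^ d - 1).
rewrite [1 + (_ - _)]addrC subrK ln_powR ltrBDr addNr powR_gt0; last lra.
by move=> /(_ isT); nra.
Qed.

Lemma ffact_le_exp (m k : nat) : (m ^_ k <= m ^ k)%N.
Proof.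
elim: k m => // k IH [|m]; first by rewrite ffact0n.
rewrite ffactSS expnS leq_mul2l; apply: leq_trans (IH m) _.
by case: k {IH} => // k; rewrite leq_exp2r.
Qed.

Lemma powR_ge_of_le (R : realType) (a B x : R) : 0 < a -> 0 <= B ->
  B `^ a^-1 <= x -> B <= x `^ a.
Proof.
move=> a0 B0 Bx.
have -> : B = (B `^ a^-1) `^ a by rewrite -powRrM mulVf ?gt_eqF ?powRr1.
apply: ge0_ler_powR; rewrite ?nnegrE ?powR_ge0 ?(ltW a0) //.
exact: le_trans (powR_ge0 _ _) Bx.
Qed.

(** * Choice of parameters *)

Lemma exists_half_quotient (N m : nat) : (0 < m)%N -> (8 * m <= N)%N ->
  exists h S : nat, [/\ (0 < S <= h)%N, (h + 2 * S * m <= N)%N,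
    (N <= 4 * h)%N, (N <= 8 * (S * m))%N & (2 * S <= N)%N].
Proof.
(* Half of the length is kept for the starting points; the progressions need 2Sm <= N/2. *)
move=> m0 mN; exists (N %/ 2)%N, (N %/ (4 * m))%N.
have hN : (2 * (N %/ 2) <= N <= 2 * (N %/ 2) + 1)%N by lia.
have S0 : (0 < N %/ (4 * m))%N by rewrite divn_gt0; lia.
have SmN : (N %/ (4 * m) * (4 * m) <= N)%N by exact: leq_trunc_div.
have NSm : (N < (N %/ (4 * m)).+1 * (4 * m))%N by rewrite ltn_ceil //; lia.
move: S0 SmN NSm hN; move: (N %/ (4 * m))%N (N %/ 2)%N => S h S0 SmN NSm hN.
by split; nia.
Qed.

(** Here m is the integer part of N^theta, with theta k = 2k/(k+1) - eps. The first largeness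
    hypothesis absorbs the constants, the second makes m large compared with k. *)
Lemma parameters_exist (R : realType) (k N : nat) (eps : R) :
  let d := eps / k%:R in let theta := 2 / k.+1%:R - d in
  (0 < k)%N -> 0 < eps <= 2^-1 ->
  192 / d <= N%:R `^ d -> (4 * k)%:R <= N%:R `^ theta ->
  exists h S m : nat,
    [/\ (0 < S <= h)%N, (h + 2 * S * m <= N)%N, (k < m <= N)%N,
        ('C(m, k) * (3 * \sum_(1 <= g < (2 * S).+1) 2 * S %/ g) <= h * S ^ 2)%N
      & N%:R `^ ((2 * k)%:R / k.+1%:R - eps) <= (2 ^ k * k`! * 'C(m, k))%:R].
Proof.
move=> d theta k0 /andP[eps0 eps1].
set n : R := N%:R; set x := n `^ theta => Nd Nx.
have k1 : 1 <= k%:R :> R by rewrite ler1n.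
have d0 : 0 < d by rewrite divr_gt0 // ltr0n.
have d1 : d <= 2^-1.
  by rewrite ler_pdivrMr ?ltr0n //; apply: (le_trans eps1); lra.
(* Hence N^d >= 384, which leaves ample room for 8m <= N. *)
have d192 : 384 <= 192 / d by rewrite ler_pdivlMr //; lra.
have N0 : (0 < N)%N.
  rewrite lt0n; apply/eqP => N0; move: Nd.
  by rewrite /n N0 powR0 ?gt_eqF //; lra.
have n1 : 1 <= n by rewrite ler1n.
have n0 : 0 < n by lra.
have kS : 0 < k.+1%:R :> R by rewrite ltr0n.
have theta_le : theta + d <= 1.
  by rewrite subrK ler_pdivrMr // mul1r ler_nat ltnS.
have nD r s : n `^ (r + s) = n `^ r * n `^ s.
  by rewrite powRD //; apply/implyP => _; rewrite gt_eqF.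
have x0 : 0 < x by rewrite powR_gt0.
have xn : 384 * x <= n.
  have : x * n `^ d <= n.
    rewrite -nD -[leRHS]powRr1; last exact: ltW.
    exact: ler_powR.
  by have : 384 <= n `^ d; [exact: le_trans Nd | nra].
pose m := Num.truncn x.
have /andP[mx xm] : m%:R <= x < m.+1%:R by apply: truncn_itv; exact: ltW.
have m4 : (4 * k <= m)%N by rewrite truncn_ge_nat // ltW.
have mN : (8 * m <= N)%N by rewrite -(ler_nat R) natrM; lra.
have m0 : (0 < m)%N by apply: leq_trans m4; rewrite muln_gt0.
have km : (k < m)%N by apply: leq_trans m4; rewrite ltn_Pmull.
have [h [S [Sh hSm N4 N8 SN]]] := exists_half_quotient m0 mN.
have /andP[S0 _] := Sh.
exists h, S, m; split=> //.
- by rewrite km (leq_trans _ mN) // leq_pmull.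
- rewrite -(ler_nat R).
  have cC : 'C(m, k)%:R <= x ^+ k.
    apply: (@le_trans _ _ (m%:R ^+ k)); last by rewrite lerXn2r ?nnegrE ?(ltW x0).
    rewrite -natrX ler_nat; apply: leq_trans (ffact_le_exp m k).
    by rewrite -bin_ffact leq_pmulr ?fact_gt0.
  have cL : 1 + ln (2 * S)%:R <= n `^ d / d.
    apply: le_trans (@ln_le_powR R d _ _ _) _.
    + by rewrite d0 /=; lra.
    + by rewrite ler1n muln_gt0.
    + rewrite ler_pM2r ?invr_gt0 //.
      apply: ge0_ler_powR; rewrite ?nnegrE ?(ltW d0) //.
      by rewrite ler_nat.
  (* Since x^(k+1) = N^(2 - (k+1)d) and k + 1 >= 2, two factors N^d are spare: one pays for the
     logarithm, the other for 192/d. The constant is 192 = 6 * 32, with 6 from the count of ratios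
     and 32 from [hS]. *)
  have main : 192 * (x ^+ k.+1 * (n `^ d / d)) <= n ^+ 2.
    have xk : x ^+ k.+1 = n `^ (2 - k.+1%:R * d).
      rewrite -powR_mulrn ?(ltW x0) // -powRrM; congr (_ `^ _).
      by rewrite /theta; field; rewrite gt_eqF.
    rewrite xk -(powR_mulrn 2) ?(ltW n0) //.
    apply: (@le_trans _ _ (n `^ (2 - k.+1%:R * d) * n `^ d * n `^ d)).
      rewrite [leLHS](_ : _ =
        n `^ (2 - k.+1%:R * d) * n `^ d * (192 / d)); last by ring.
      by rewrite ler_wpM2l // mulr_ge0 ?powR_ge0.
    rewrite -!nD; apply: ler_powR => //.
    suff : 2 * d <= k.+1%:R * d by lra.
    by rewrite ler_pM2r // ler_nat.
  have hS : n ^+ 2 <= 32 * (h * S)%:R * m%:R.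
    rewrite -natrX -!natrM ler_nat.
    apply: leq_trans (leq_mul N4 N8) _.
    by rewrite mulnACA !mulnA.
  rewrite -mulnn !natrM; have := @sum_divn_le_ln R (2 * S).
  set D := (\sum_(1 <= g < _) _)%N => cD.
  have cDd : D%:R <= (2 * S)%:R * (n `^ d / d).
    by apply: le_trans cD _; rewrite ler_wpM2l.
  apply: (@le_trans _ _ (x ^+ k * (3 * ((2 * S)%:R * (n `^ d / d))))).
    by rewrite ler_pM ?mulr_ge0 ?ler_wpM2l.
  set q := x ^+ k * (n `^ d / d).
  have -> : x ^+ k * (3 * ((2 * S)%:R * (n `^ d / d))) = 6 * q * S%:R.
    by rewrite /q natrM; ring.
  have -> : h%:R * (S%:R * S%:R) = (h * S)%:R * S%:R :> R.
    by rewrite natrM; ring.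
  rewrite ler_wpM2r // -(ler_pM2l x0).
  have qE : x ^+ k.+1 * (n `^ d / d) = x * q by rewrite exprS /q; ring.
  have hSx : (h * S)%:R * m%:R <= (h * S)%:R * x :> R by rewrite ler_wpM2l.
  rewrite qE in main; lra.
- have -> : (2 * k)%:R / k.+1%:R - eps = theta * k%:R.
    rewrite /theta /d natrM; field.
    by rewrite pnatr_eq0 -lt0n k0 gt_eqF.
  rewrite powRrM powR_mulrn; last exact: ltW.
  (* From x < m + 1 and 4k <= x one gets x <= 2(m - k), the source of the factor 2^k. *)
  apply: (@le_trans _ _ ((2 * (m - k)%:R) ^+ k)).
    rewrite lerXn2r ?nnegrE ?(ltW x0) ?mulr_ge0 // natrB; last exact: ltnW.
    rewrite -natr1 in xm; rewrite natrM in Nx.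
    have : 4 * k%:R <= x by [].
    rewrite -/x; lra.
  rewrite exprMn -!natrX -natrM ler_nat -mulnA leq_mul2l.
  by apply/orP; right; rewrite mulnC bin_ge.
Qed.

(** * Intervals of residues and the final constant *)

Lemma Fp_intervalP (p : nat) (I : {set 'F_p}) : prime p -> Fp_interval I ->
  exists a : 'F_p, I = [set a + i%:R | i : 'I_#|I|].
Proof.
move=> p_pr [M [N [/andP[_ Np] IE]]].
have {}IE : I = [set (M + 1)%:~R + i%:R | i : 'I_N].
  rewrite IE; apply: eq_imset => i.
  by rewrite -[i.+1]add1n PoszD addrA !intrD.
suff cI : #|I| = N by exists (M + 1)%:~R; rewrite cI.
rewrite IE card_imset ?card_ord // => i j /addrI /(congr1 val) /=.
have lt_p (r : 'I_N) : (r < p)%N := leq_trans (ltn_ord r) Np.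
by rewrite !val_Fp_nat // !modn_small // => /val_inj.
Qed.

Lemma recip_sumset_neq0 (p k : nat) (I : {set 'F_p}) : I != finset.set0 ->
  (0 < #|recip_sumset k I|)%N.
Proof.
move=> /finset.set0Pn[x xI]; apply/card_gt0P; exists (\sum_(i < k) x^-1).
apply/imsetP; exists [ffun=> x].
  by apply/ffun_onP => i; rewrite ffunE.
by apply: eq_bigr => i _; rewrite ffunE.
Qed.

(** Below a threshold [T] for |I| the trivial bound 1 suffices; above it the parameters exist. As
    2k/(k+1) >= 1, the bound eps <= 1/2 keeps the exponent [e] positive. *)
Lemma recip_sumset_lower_bound (R : realType) (k : nat) (eps : R) :
  (0 < k)%N -> 0 < eps <= 2^-1 ->
  exists c : R, 0 < c /\
    forall (p : nat) (I : {set 'F_p}),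
      prime p -> Fp_interval I -> 0 \notin I -> (#|I| ^ 2 < p)%N ->
      (0 < #|I|)%N ->
      c * #|I|%:R `^ ((2 * k)%:R / k.+1%:R - eps) < #|recip_sumset k I|%:R.
Proof.
move=> k0 eps_bd; have /andP[eps0 eps1] := eps_bd.
pose d := eps / k%:R; pose theta := 2 / k.+1%:R - d.
pose e := (2 * k)%:R / k.+1%:R - eps.
have k1 : 1 <= k%:R :> R by rewrite ler1n.
have kS : 0 < k.+1%:R :> R by rewrite ltr0n.
have d0 : 0 < d by rewrite divr_gt0 // ltr0n.
have e_gt : 0 < e.
  rewrite /e subr_gt0; apply: (le_lt_trans eps1).
  by rewrite ltr_pdivlMr // natrM -[k.+1%:R]natr1; lra.
have e_le : e <= 2.
  rewrite /e lerBlDr; apply: (@le_trans _ _ 2); last lra.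
  by rewrite ler_pdivrMr // natrM -[k.+1%:R]natr1; lra.
have theta0 : 0 < theta.
  have -> : theta = e / k%:R.
    by rewrite /theta /e /d natrM; field; rewrite !gt_eqF //; lra.
  by rewrite divr_gt0 //; lra.
(* The two largeness conditions on N, solved for N. *)
pose T := Num.max ((192 / d) `^ d^-1) ((4 * k)%:R `^ theta^-1).
have T0 : 0 <= T by rewrite le_max powR_ge0.
pose q : R := (2 ^ k * k`! * (2 * k).+1)%:R.
have q0 : 0 < q by rewrite ltr0n !muln_gt0 expn_gt0 fact_gt0.
have T1 : 0 < 2 * (T + 1) ^+ 2 by rewrite mulr_gt0 // exprn_gt0 //; lra.
(* The first entry serves N >= T, the second N < T, where N^e <= N^2 <= (T+1)^2. The factors 2 give
   strict inequalities. *)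
exists (Num.min (2 * q)^-1 (2 * (T + 1) ^+ 2)^-1).
split; first by rewrite lt_min !invr_gt0 T1 mulr_gt0.
move=> p I p_pr /(Fp_intervalP p_pr)[a IE] I0 Ip N0.
set N := #|I| in IE Ip N0 *.
have cge : (0 < #|recip_sumset k I|)%N.
  by apply: recip_sumset_neq0; rewrite -card_gt0.
have N1 : 1 <= N%:R :> R by rewrite ler1n.
have Ne0 : 0 < N%:R `^ e :> R by apply: powR_gt0; lra.
have [TN|NT] := leP T N%:R; last first.
  apply: (@lt_le_trans _ _ 1); last by rewrite ler1n.
  apply: (@le_lt_trans _ _ ((2 * (T + 1) ^+ 2)^-1 * N%:R `^ e)).
    by rewrite ler_wpM2r ?(ltW Ne0) // ge_min lexx orbT.
  rewrite mulrC ltr_pdivrMr // mul1r.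
  apply: (@le_lt_trans _ _ (N%:R ^+ 2)).
    by rewrite -powR_mulrn //; apply: ler_powR.
  have : N%:R ^+ 2 <= (T + 1) ^+ 2 by rewrite lerXn2r ?nnegrE //; lra.
  move: T1; lra.
have := @parameters_exist R k N eps k0 eps_bd.
rewrite -/d -/theta.
case.
- apply: powR_ge_of_le => //; first by apply: divr_ge0; lra.
  by apply: le_trans TN; rewrite le_max lexx.
- by apply: powR_ge_of_le => //; apply: le_trans TN; rewrite le_max lexx orbT.
move=> h [S [m [Sh hSm /andP[km mN] bin_le Ne_le]]].
have Np : (N <= p)%N by apply: leq_trans (ltnW Ip); rewrite leq_pmulr.
have main : ('C(m, k) <= (2 * k).+1 * #|recip_sumset k I|)%N.
  rewrite IE; apply: (@recip_sumset_ge_bin p k h S m N a) => //.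
  - by apply: leq_trans km (leq_trans mN Np).
  (* As m >= 2, the length condition gives h + 4S <= N, so 4hS <= (h + 4S)^2 <= N^2 < p. *)
  - apply: leq_trans (ltnW Ip); have /andP[S0 _] := Sh.
    have m2 : (2 <= m)%N by apply: leq_ltn_trans km.
    have {hSm} : (h + 4 * S <= N)%N.
      apply: leq_trans hSm; rewrite leq_add2l mulnAC leq_mul2r.
      by rewrite (leq_mul (leqnn 2) m2) orbT.
    by move: N {IE Ip N0 N1 Ne0 TN mN Ne_le Np} => n; rewrite -mulnn; nia.
  - exact: leq_trans mN Np.
  - by rewrite -IE.
apply: (@le_lt_trans _ _ ((2 * q)^-1 * N%:R `^ e)).
  by rewrite ler_wpM2r ?(ltW Ne0) // ge_min lexx.
rewrite mulrC ltr_pdivrMr ?mulr_gt0 //.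
apply: le_lt_trans Ne_le _.
apply: (@le_lt_trans _ _ (q * #|recip_sumset k I|%:R)).
  by rewrite -natrM ler_nat -[leqRHS]mulnA leq_mul2l main orbT.
have : 0 < q * #|recip_sumset k I|%:R by rewrite mulr_gt0 // ltr0n.
by rewrite mulrC; lra.
Qed.

Theorem corollary1 (R : realType) (k : nat) (hk : (0 < k)%N)
    (eps : R) (heps : 0 < eps) :
  exists c : R, 0 < c /\
    forall (p : nat) (I : {set 'F_p}),
      prime p -> Fp_interval I -> 0 \notin I ->
      (#|I|%:R : R) < p%:R `^ (1 / 2) ->
      c * #|I|%:R `^ ((2 * k)%:R / k.+1%:R - eps) < #|recip_sumset k I|%:R.
Proof.
(* Since |I| >= 1, a smaller eps gives a stronger bound, so eps may be capped at 1/2. *)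
pose eps' := Num.min eps 2^-1.
have eps'_bd : 0 < eps' <= 2^-1.
  by rewrite lt_min heps ge_min lexx orbT invr_gt0 ltr0n.
have [c [c0 cP]] := recip_sumset_lower_bound hk eps'_bd.
exists c; split=> // p I p_pr Iint I0 Ip.
have cI0 : (0 < #|I|)%N.
  have [M [N [/andP[N0 _] ->]]] := Iint.
  by apply/card_gt0P; exists (M + 1)%:~R; apply/imsetP; exists (Ordinal N0).
have Ip2 : (#|I| ^ 2 < p)%N.
  rewrite -(ltr_nat R) natrX.
  have -> : p%:R = (p%:R `^ (1 / 2)) ^+ 2 :> R.
    by rewrite -powR_mulrn ?powR_ge0 // -powRrM divfK ?powRr1.
  by rewrite ltrXn2r ?nnegrE ?powR_ge0.
apply: le_lt_trans (cP p I p_pr Iint I0 Ip2 cI0).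
rewrite ler_wpM2l ?(ltW c0) //; apply: ler_powR; first by rewrite ler1n.
by rewrite lerD2l lerN2 ge_min lexx.
Qed.
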